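(* Let $r$ be a positive integer, $\boldsymbol{\omega}=(\omega_1,\ldots,\omega_r)$ an $r$-tuple of positive real numbers and $a\ge 0$. Then, as $x\to 0^+$, \[ I_r(x;\boldsymbol{\omega},a)=\frac{e^{-\gamma x}}{\Gamma(x+1)}\sum_{k=0}^r(-1)^k\Lambda_k(\boldsymbol{\omega})\frac{(r-k)!}{x^{r-k}}+O(x). \]
   Context: For real $x>0$, \[ I_r(x;\boldsymbol{\omega},a)=\int_1^\infty\cdots\int_1^\infty\frac{dt_1\cdots dt_r}{t_1\cdots t_r(\omega_1t_1+\cdots+\omega_rt_r+a)^x}. \] $\gamma$ is Euler's constant and $\Gamma$ the gamma function. $\Lambda_0(\boldsymbol{\omega})=1$ and, for $k\ge1$, $\Lambda_k(\boldsymbol{\omega})=\sum_{1\le i_1<\cdots<i_k\le r}\log\omega_{i_1}\cdots\log\omega_{i_k}$. *)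

(* Defs.v *)
From mathcomp Require Import all_boot all_order all_algebra.
From mathcomp Require Import all_classical all_reals all_analysis.
Set Implicit Arguments.
Unset Strict Implicit.
Unset Printing Implicit Defensive.
Import Order.TTheory GRing.Theory Num.Theory.
Import numFieldNormedType.Exports.
Local Open Scope classical_set_scope.
Local Open Scope ring_scope.

Definition euler_gamma (R : realType) : R :=
  limn (fun n : nat => \sum_(1 <= k < n.+1) (k%:R : R)^-1 - ln n%:R).

Definition Gamma (R : realType) (s : R) : R :=
  \int[@lebesgue_measure R]_(t in `]0, +oo[) (t `^ (s - 1) * expR (- t)).

(* The integral over [1, +oo[ ^ r as an iterated Lebesgue integral, outermost in
   the first variable.  Every level takes values in \bar R, so a divergent inner
   integral counts as +oo.  The order of integration is immaterial (Tonelli) for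
   the nonnegative measurable integrands used below. *)
Fixpoint iterated_integral1y (R : realType) (r : nat) :
    (r.-tuple R -> \bar R) -> \bar R :=
  if r is r'.+1 then fun f =>
    (\int[@lebesgue_measure R]_(t in `[1%R, +oo[)
      iterated_integral1y (fun s : r'.-tuple R => f [tuple of t :: s]))%E
  else fun f => f [tuple].

Definition Ir_ext (R : realType) (r : nat) (x : R) (omega : r.-tuple R)
    (a : R) : \bar R :=
  iterated_integral1y (fun t : r.-tuple R =>
    (((\prod_(i < r) tnth t i) *
      (\sum_(i < r) tnth omega i * tnth t i + a) `^ x)^-1)%:E).

(* [fine] sends +oo to 0, but the integral converges when x > 0, all omega_i > 0
   and a >= 0. *)
Definition Ir (R : realType) (r : nat) (x : R) (omega : r.-tuple R) (a : R) : R :=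
  fine (Ir_ext x omega a).

(* The indices i_1 < ... < i_k are encoded by the k-element subset
   {i_1, ..., i_k}; the empty product gives Lambda 0 omega = 1. *)
Definition Lambda (R : realType) (r k : nat) (omega : r.-tuple R) : R :=
  \sum_(A : {set 'I_r} | #|A| == k) \prod_(i in A) ln (tnth omega i).

(* Main.v *)
Require Import Defs.
From mathcomp Require Import all_boot all_order all_algebra.
From mathcomp Require Import all_classical all_reals all_analysis.
From mathcomp Require Import measurable_realfun ring lra.
Import Order.TTheory GRing.Theory Num.Theory.
Import numFieldNormedType.Exports.
Local Open Scope classical_set_scope.
Local Open Scope ring_scope.

(* Let E1 z = int_1^oo e^(-z t) / t dt.  Writing
     Gamma(x+1) / A^x = x int_0^oo u^(x-1) e^(-A u) du
   and exchanging integrals (Tonelli) gives, for 0 < x <= 1,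
     I_r(x; omega, a) =
       1 / Gamma(x+1) * int_0^oo x u^(x-1) e^(-a u) prod_i E1(omega_i u) du.
   Since E1 z = - gamma - ln z + O(z), on ]0, c] with c = e^(-gamma) the product
   may be replaced by prod_i (L u - ln omega_i), L u = - gamma - ln u, and
     int_0^c x u^(x-1) (L u)^m du = e^(-gamma x) m! / x^m
   yields exactly the main term: c is chosen so that L c = 0.  The replacement
   error is x times an integral of u^x O(u^(-1/2)), the part over ]c, +oo[ is x
   times a bounded quantity, and Gamma(x+1) >= 1/e, so the rest is O(x). *)

(** Every exchange of integrals concerns nonnegative integrands valued in the extended reals, so the
    Mellin formula is available before convergence is known; finiteness only comes from the final
    bounds on the two pieces. Since gamma is defined as the limit of H_n - ln n, the expansion of E1
    is obtained by comparing E1 z + ln z with finite sums whose value at n is H_n. On ]0, c] the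
    factor L u is nonnegative, so the powers of L can be integrated up to the singularity at 0 by
    monotone convergence. A product of r logarithms is unbounded at 0 but stays below every negative
    power of u; the exponent 1/2 is one choice in ]0, 1[, which keeps the replacement error
    integrable on ]0, c] uniformly in x. *)

(** * Calculus: derivatives, and the fundamental theorem on half-open and unbounded intervals *)

Lemma ge0_is_derive_le {R : realType} (f f' : R -> R) (a b : R) : a <= b ->
  (forall x, a <= x <= b -> is_derive x 1 f (f' x)) ->
  (forall x, a <= x <= b -> 0 <= f' x) -> f a <= f b.
Proof.
move=> ab df f'0.
have df' x : x \in `[a, b] -> derivable f x 1.
  by rewrite in_itv/= => /df[].
apply: (@ger0_derive1_ndecr _ f a b) => //.
- by move=> x xab; apply: df'; apply: subset_itv_oo_cc xab.
- move=> x; rewrite in_itv/= => /andP[/ltW ax /ltW xb].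
  have axb : a <= x <= b by rewrite ax.
  by have [_] := df _ axb; rewrite derive1E => ->; exact: f'0.
- exact: derivable_within_continuous.
Qed.

Lemma is_derive_continuous {R : realType} (f : R -> R) (x l : R) :
  is_derive x 1 f l -> {for x, continuous f}.
Proof. by move=> [df _]; exact/differentiable_continuous/derivable1_diffP. Qed.

Lemma is_derive_congr {R : realType} (f g : R -> R) (x l m : R) :
  is_derive x 1 f l -> f =1 g -> l = m -> is_derive x 1 g m.
Proof. by move=> + /funext <- <-. Qed.

(** The hypothesis keeps the difference quotient within |g y - g z| of g z, and continuity of g
    closes the gap. This suits a convex or concave f with known slopes: no differentiation under an
    integral sign occurs. *)
Lemma squeeze_is_derive {R : realType} (f g : R -> R) (z : R) :
  {for z, continuous g} ->
  (\forall y \near z, `|f y - f z - g z * (y - z)| <=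
      `|g y - g z| * `|y - z|) ->
  is_derive z 1 f (g z).
Proof.
move=> cg fg.
have : (h^-1 *: (f (h + z) - f z) @[h --> 0^']) --> g z.
  apply/cvgrPdist_le => /= e e0.
  have ge : \forall y \near z, `|g z - g y| <= e.
    by move/cvgrPdist_le : cg; exact.
  have [d /= d0 H] := (nbhs_ballP _ _).1 (filterI fg ge).
  near=> h.
  have h0 : h != 0 by near: h; exact: nbhs_dnbhs_neq.
  have [/= h1 h2] : `|f (z + h) - f z - g z * (z + h - z)| <=
      `|g (z + h) - g z| * `|z + h - z| /\ `|g z - g (z + h)| <= e.
    apply: H; rewrite /ball/= opprD addNKr normrN.
    by near: h; exact: dnbhs0_lt.
  rewrite /GRing.scale/= (addrC h).
  have hn : 0 < `|h| by rewrite normr_gt0.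
  rewrite -(ler_pM2r hn) -normrM (le_trans _ (ler_wpM2r (ltW hn) h2))//.
  move: h1; rewrite (_ : z + h - z = h) => [h1|]; last by ring.
  rewrite -normrN distrC in h1; apply: le_trans h1; rewrite le_eqVlt; apply/orP; left.
  by apply/eqP; congr `| _ |; field.
rewrite (_ : (fun h => _) = (fun h => h^-1 *: (f (h *: (1 : R) + z) - f z))); last first.
  by apply/funext => h; rewrite /GRing.scale/= mulr1.
by move=> H; apply: DeriveDef; [exact: cvgP H | exact: cvg_lim H].
Unshelve. all: by end_near. Qed.

Lemma in_continuous_within {R : realType} (A : set R) (f : R -> R) :
  (forall x, A x -> {for x, continuous f}) -> {within A, continuous f}.
Proof.
by move=> cf; apply: continuous_in_subspaceT => x; rewrite inE; exact: cf.
Qed.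

(* Unlike [continuous_FTC2], covers integrands with an integrable singularity
   at [0]. *)
Lemma ge0_FTC2_at0 {R : realType} (f F : R -> R) (b : R) : 0 < b ->
  (forall x, 0 < x <= b -> 0 <= f x) ->
  (forall x : R, 0 < x -> {for x, continuous f}) ->
  (forall x : R, 0 < x -> is_derive x 1 F (f x)) ->
  F x @[x --> 0^'+] --> 0 ->
  (\int[@lebesgue_measure R]_(x in `]0%R, b]) (f x)%:E = (F b)%:E)%E.
Proof.
move=> b0 f0 cf dF F0.
(* The denominator starts at 2 so that every interval is nondegenerate, as the fundamental theorem
   on [b / (n + 2), b] requires. *)
pose I n := `[b / n.+2%:R, b]%classic : set R.
have bn_gt0 n : 0 < b / n.+2%:R by rewrite divr_gt0.
have UI : \bigcup_n I n = `]0%R, b]%classic.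
  apply/seteqP; split => [x [n _]|x]; rewrite /I /= !in_itv/=.
    by move=> /andP[nx ->]; rewrite (lt_le_trans _ nx).
  move=> /andP[x0 xb]; exists (Num.truncn (b / x)) => //=.
  rewrite in_itv/= xb andbT ler_pdivrMr// mulrC -ler_pdivrMr//.
  by rewrite (le_trans (ltW (truncnS_gt _)))// ler_nat.
have : (\int[@lebesgue_measure R]_(x in I n) (f x)%:E @[n --> \oo] -->
    \int[@lebesgue_measure R]_(x in \bigcup_i I i) (f x)%:E)%E.
  apply: ge0_nondecreasing_set_cvg_integral; rewrite /I //.
  - move=> n m nm; rewrite subsetEset; apply: subset_itvr.
    by rewrite bnd_simp ler_pM2l// lef_pV2 ?posrE// ler_nat !ltnS.
  - move=> n; apply/measurable_EFinP; apply: subspace_continuous_measurable_fun => //.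
    apply: in_continuous_within => x; rewrite /I/= in_itv/= => /andP[x0 _].
    by apply: cf; rewrite (lt_le_trans _ x0).
  - move=> n x; rewrite /I/= in_itv/= => /andP[x0 xb].
    by rewrite lee_fin f0// xb andbT (lt_le_trans _ x0).
rewrite UI => cvgI.
have : ((F b - F (b / n.+2%:R))%:E @[n --> \oo] --> (F b)%:E)%E.
  apply: cvg_EFin; first exact: nearW.
  rewrite -[X in _ --> X]subr0; apply: cvgB; first exact: cvg_cst.
  have := (cvg_at_rightP F 0 0).1 F0 (fun n => b / n.+2%:R).
  apply; split => [//|].
  rewrite -[X in _ --> X](mulr0 b); apply: cvgM; first exact: cvg_cst.
  by have := @cvg_harmonic R; rewrite -(@cvg_shiftS R^o).
move=> /cvg_lim <- //; apply/esym/cvg_lim => //.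
apply: cvg_trans cvgI; apply: near_eq_cvg; apply: nearW => n.
have bnb : b / n.+2%:R < b by rewrite ltr_pdivrMr// ltr_pMr// ltr1n.
have gt0 x : x \in `[b / n.+2%:R, b] -> 0 < x.
  by rewrite in_itv/= => /andP[x0 _]; rewrite (lt_le_trans _ x0).
have gt0' x : x \in `]b / n.+2%:R, b[ -> 0 < x.
  by move=> /subset_itv_oo_cc; exact: gt0.
rewrite /I EFinB; apply: continuous_FTC2 => //.
- by apply: in_continuous_within => x /gt0/cf.
- split; first by move=> x /gt0' /dF[].
  + exact/cvg_at_right_filter/(is_derive_continuous _ _ _ (dF _ _)).
  + exact/cvg_at_left_filter/(is_derive_continuous _ _ _ (dF _ b0)).
- by move=> x /gt0' /dF[_]; rewrite derive1E.
Qed.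

Lemma integral_expR_itvy {R : realType} (z c : R) : 0 < z ->
  (\int[@lebesgue_measure R]_(t in `[c, +oo[) (expR (- (z * t)))%:E =
   (expR (- (z * c)) / z)%:E)%E.
Proof.
move=> z0; have zN0 : z != 0 by rewrite gt_eqF.
have dF (t : R) : is_derive t 1 (fun t : R => - (expR (- (z * t)) / z)) (expR (- (z * t))).
  have dz : is_derive t 1 (fun t : R => - (z * t)) (- z).
    rewrite (_ : (fun t => - (z * t)) = (fun t => (- z) *: t)).
      by apply: is_derive_eq; rewrite /GRing.scale/= mulr1.
    by apply/funext => x; rewrite /GRing.scale/= mulNr.
  have de := is_derive1_comp (is_derive_expR _) dz.
  rewrite (_ : (fun t => _) = (fun t => (- z^-1) *: (expR \o (fun t => - (z * t))) t)).
    by apply: is_derive_eq; rewrite /GRing.scale/=; field.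
  by apply/funext => x; rewrite /GRing.scale/= mulrC mulNr.
have cF t : {for t, continuous (fun t => - (expR (- (z * t)) / z))}.
  by apply: is_derive_continuous (dF t).
rewrite (@ge0_continuous_FTC2y _ _ (fun t => - (expR (- (z * t)) / z)) _ 0).
- by rewrite sub0e -EFinN opprK.
- by move=> x _; exact: expR_ge0.
- apply: continuous_subspaceT => x.
  apply: continuous_comp; last exact: continuous_expR.
  by apply: (@continuousN _ R^o); exact: mulrl_continuous.
- rewrite -[X in _ --> X]oppr0 -[X in - X](mul0r z^-1).
  apply: cvgN; apply: cvgM; last exact: cvg_cst.
  apply: (cvg_comp (fun t => z * t) (fun y => expR (- y))); last exact: cvgr_expR.
  exact: gt0_cvgMry.
- by move=> x _; have [] := dF x.
- by move=> ?; apply: cvg_at_right_filter; exact: cF.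
- by move=> x _; rewrite derive1E; have [_ ->] := dF x.
Qed.

(** * The exponential integral E1: bounds, monotonicity, derivative *)

Definition expint1 {R : realType} (z : R) : R :=
  \int[@lebesgue_measure R]_(t in `[1, +oo[) (expR (- (z * t)) / t).

Section expint1.
Context {R : realType}.
Notation mu := (@lebesgue_measure R).
Implicit Types z w : R.

Lemma measurable_expR_mul z (D : set R) :
  measurable_fun D (fun t : R => expR (- (z * t))).
Proof.
apply: measurable_funTS; apply: measurableT_comp => //.
apply: measurable_funN; exact: mulrl_measurable.
Qed.

Lemma measurable_inv_itv1y : measurable_fun (`[1, +oo[ : set R) (fun t : R => t^-1).
Proof.
apply: (@measurable_funS _ _ _ _ (`]0, +oo[ : set R)) => //.
  by apply: subset_itvr; rewrite bnd_simp.
apply: open_continuous_measurable_fun => // t.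
by rewrite inE/= in_itv/= andbT => t0; apply: inv_continuous; rewrite gt_eqF.
Qed.

Lemma integrable_expR_itvy z c : 0 < z ->
  mu.-integrable `[c, +oo[ (EFin \o (fun t : R => expR (- (z * t)))).
Proof.
move=> z0; apply/integrableP; split.
  by apply/measurable_EFinP; exact: measurable_expR_mul.
under eq_integral do rewrite /= ger0_norm ?expR_ge0//.
by rewrite integral_expR_itvy// ltry.
Qed.

Lemma integrable_expint1 z : 0 < z ->
  mu.-integrable `[1, +oo[ (EFin \o (fun t : R => expR (- (z * t)) / t)).
Proof.
move=> z0; apply: le_integrable (integrable_expR_itvy z 1 z0) => //.
  apply/measurable_EFinP; apply: measurable_funM.
    exact: measurable_expR_mul.
  exact: measurable_inv_itv1y.
move=> t /=; rewrite in_itv/= andbT => t1.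
have t0 : 0 < t by rewrite (lt_le_trans _ t1).
rewrite lee_fin normrM ler_piMr// normfV invf_le1 ?normr_gt0 ?gt_eqF//.
by rewrite ger0_norm// ltW.
Qed.

Lemma expint1E z : 0 < z ->
  (\int[mu]_(t in `[1%R, +oo[) (expR (- (z * t)) / t)%:E = (expint1 z)%:E)%E.
Proof.
by move=> z0; rewrite /expint1 /Rintegral fineK// integrable_fin_num// integrable_expint1.
Qed.

Lemma expint1_ge0 z : 0 <= expint1 z.
Proof.
apply: Rintegral_ge0 => t; rewrite /= in_itv/= andbT => t1.
by rewrite divr_ge0 ?expR_ge0// (le_trans _ t1).
Qed.

Lemma Rintegral_expR_itvy z c : 0 < z ->
  \int[mu]_(t in `[c, +oo[) expR (- (z * t)) = expR (- (z * c)) / z.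
Proof. by move=> z0; rewrite /Rintegral integral_expR_itvy. Qed.

Lemma expint1_le z : 0 < z -> expint1 z <= expR (- z) / z.
Proof.
move=> z0; rewrite -[X in expR (- X)]mulr1 -Rintegral_expR_itvy//.
apply: le_Rintegral => //; [exact: integrable_expint1|exact: integrable_expR_itvy|].
move=> t; rewrite /= in_itv/= andbT => t1.
by rewrite ler_piMr ?expR_ge0// invf_le1// (lt_le_trans _ t1).
Qed.

(** Tangent-line inequality of the convex function E1: e^(-z t) >= e^(-w t) (1 + (w - z) t) is
    divided by t and integrated. The sign of w - z is free, so this one inequality yields both
    monotonicity and the derivative. *)
Lemma expint1B_ge z w : 0 < z -> 0 < w ->
  (w - z) * (expR (- w) / w) <= expint1 z - expint1 w.
Proof.
move=> z0 w0; rewrite -[X in expR (- X)](mulr1 w) -Rintegral_expR_itvy//.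
rewrite -RintegralZl//; last exact: integrable_expR_itvy.
rewrite -RintegralB//; [|exact: integrable_expint1|exact: integrable_expint1].
apply: le_Rintegral => //.
- by apply: (integrableZl _ _ (integrable_expR_itvy w 1 w0)).
- by apply: (integrableB _ (integrable_expint1 z z0) (integrable_expint1 w w0)).
move=> t; rewrite /= in_itv/= andbT => t1.
have t0 : 0 < t by rewrite (lt_le_trans _ t1).
rewrite -mulrBl ler_pdivlMr// mulrAC.
rewrite (_ : expR (- (z * t)) = expR (- (w * t)) * expR ((w - z) * t)).
  rewrite -[X in _ <= _ - X]mulr1 -mulrBr mulrC ler_wpM2l ?expR_ge0//.
  by rewrite lerBrDl expR_ge1Dx.
by rewrite -expRD; congr expR; ring.
Qed.

Lemma expint1_nincr z w : 0 < z -> z <= w -> expint1 w <= expint1 z.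
Proof.
move=> z0 zw; have w0 := lt_le_trans z0 zw.
rewrite -subr_ge0; apply: le_trans (expint1B_ge z w z0 w0).
by rewrite mulr_ge0 ?subr_ge0// divr_ge0 ?expR_ge0 ?ltW.
Qed.

(** With g y = - e^(-y) / y, applying [expint1B_ge] to (z, y) and to (y, z) traps the increment of
    E1 between g z (y - z) and g y (y - z). *)
Lemma is_derive_expint1 z : 0 < z ->
  is_derive z 1 expint1 (- (expR (- z) / z)).
Proof.
move=> z0.
apply: (squeeze_is_derive expint1 (fun z => - (expR (- z) / z))).
  apply: (@continuousN _ R^o); apply: continuousM.
    apply: continuous_comp; [exact: (@oppr_continuous _ R^o)|exact: continuous_expR].
  by apply: inv_continuous; rewrite gt_eqF.
have : \forall y \near z, 0 < y by exact: lt_nbhsr.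
apply: filterS => y y0.
have := expint1B_ge z y z0 y0.
have := expint1B_ge y z y0 z0.
move: (expR (- z) / z) (expR (- y) / y) (expint1 z) (expint1 y) => p q E F h1 h2.
rewrite -normrM ler_norml; apply/andP.
have [h|h] := lerP 0 ((- q - - p) * (y - z)).
  by rewrite (ger0_norm h); split; nra.
by rewrite (ltr0_norm h); split; nra.
Qed.

End expint1.

(** * Euler's constant and the behaviour of E1 at 0 *)

Lemma bernoulli_expr {R : realDomainType} (y : R) n : y <= 1 -> 1 - n%:R * y <= (1 - y) ^+ n.
Proof.
move=> y1; elim: n => [|n ih]; first by rewrite mul0r subr0 expr0.
rewrite exprS (le_trans _ (ler_wpM2l _ ih)) ?subr_ge0//.
rewrite -natr1; have : 0 <= n%:R * (y * y) by rewrite mulr_ge0// -expr2 sqr_ge0.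
lra.
Qed.

Section euler_gamma_expint1.
Context {R : realType}.
Implicit Types (n : nat) (s z : R).

(* [p n] is the primitive of [(1 - (1 - s / n) ^ n) / s] (a geometric sum)
   vanishing at [0], and [p n n] is the [n]-th harmonic number; [g' s] is
   [(1 - e ^ (- s)) / s].  The two derivatives differ by at most
   [s e ^ (- s) / n]. *)
Let q n s : R := 1 - s / n%:R.
Let p n s : R := \sum_(k < n) (1 - q n s ^+ k.+1) / k.+1%:R.
Let g s : R := expint1 s + ln s.
Let u n : R := \sum_(1 <= k < n.+1) (k%:R : R)^-1 - ln n%:R.

Let is_derive_p n s : (0 < n)%N -> 0 < s -> is_derive s 1 (p n) ((1 - q n s ^+ n) / s).
Proof.
move=> n0 s0; have N0 : n%:R != 0 :> R by rewrite pnatr_eq0 -lt0n.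
have -> : (1 - q n s ^+ n) / s = \sum_(k < n) q n s ^+ k / n%:R.
  rewrite -mulr_suml -[1 in LHS](expr1n R n) subrXX.
  under eq_bigr do rewrite expr1n mul1r.
  rewrite (_ : 1 - q n s = s / n%:R); last by rewrite /q; ring.
  by field; rewrite N0 gt_eqF.
have -> : p n = \sum_(k < n) (fun s => (1 - q n s ^+ k.+1) / k.+1%:R).
  by apply/funext => t; rewrite fct_sumE.
apply: is_derive_sum => k.
have dq : is_derive s 1 (q n) (- n%:R^-1).
  have -> : q n = cst 1 - (n%:R^-1 *: @id R).
    by apply/funext => t; rewrite /q/= /GRing.scale/= mulrC.
  by apply: is_derive_eq; rewrite /GRing.scale/= mulr1 sub0r.
have -> : (fun s => (1 - q n s ^+ k.+1) / k.+1%:R) =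
    k.+1%:R^-1 *: (cst 1 - q n ^+ k.+1).
  by apply/funext => t; rewrite !fctE /= /GRing.scale/= mulrC.
apply: is_derive_eq; rewrite /GRing.scale/= sub0r.
by rewrite !mulrN opprK -mulrA mulKf ?pnatr_eq0.
Qed.

Let is_derive_g s : 0 < s -> is_derive s 1 g ((1 - expR (- s)) / s).
Proof.
move=> s0; apply: is_derive_congr (is_deriveD (is_derive_expint1 s s0) (is_derive1_ln s0)) _ _ => //.
by rewrite mulrBl mul1r addrC.
Qed.

(** By Bernoulli, 1 - (1 - s / n)^(k + 1) <= (k + 1) s / n, so each of the n terms is at most s /
    n. *)
Let p_bounds n s : (0 < n)%N -> 0 < s <= n%:R -> 0 <= p n s <= s.
Proof.
move=> n0 /andP[s0 sn]; have N0 : 0 < n%:R :> R by rewrite ltr0n.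
have t0 : 0 <= s / n%:R by rewrite divr_ge0// ltW.
have t1 : s / n%:R <= 1 by rewrite ler_pdivrMr// mul1r.
apply/andP; split.
  apply: sumr_ge0 => k _; rewrite divr_ge0// subr_ge0 exprn_ile1// /q; lra.
rewrite [leRHS](_ : s = \sum_(k < n) (s / n%:R)); last first.
  by rewrite sumr_const card_ord -[RHS]mulr_natr divfK// gt_eqF.
apply: ler_sum => k _; rewrite ler_pdivrMr//.
have := bernoulli_expr _ k.+1 t1; rewrite /q; lra.
Qed.

(** Put t = s / n, so that e^(-s) = (e^(-t))^n. The lower bound is 1 - t <= e^(-t). For the upper
    one, 1 + t <= e^t gives e^(-t) (1 - t^2) <= 1 - t; taking n-th powers and applying Bernoulli to
    t^2 gives (1 - t)^n >= e^(-s) (1 - n t^2). *)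
Let derive_bounds n s : (0 < n)%N -> 0 < s <= n%:R ->
  0 <= (1 - q n s ^+ n) / s - (1 - expR (- s)) / s <= s * expR (- s) / n%:R.
Proof.
move=> n0 /andP[s0 sn]; have N0 : 0 < n%:R :> R by rewrite ltr0n.
have t0 : 0 <= s / n%:R by rewrite divr_ge0// ltW.
have t1 : s / n%:R <= 1 by rewrite ler_pdivrMr// mul1r.
have tE : s = n%:R * (s / n%:R) by field; rewrite gt_eqF.
have q0 : 0 <= q n s by rewrite /q subr_ge0.
have eE : expR (- s) = expR (- (s / n%:R)) ^+ n.
  by rewrite -expRM_natl mulrN -tE.
have -> : (1 - q n s ^+ n) / s - (1 - expR (- s)) / s = (expR (- s) - q n s ^+ n) / s.
  by rewrite -mulrBl; congr (_ / _); ring.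
apply/andP; split.
  rewrite divr_ge0 ?(ltW s0)// subr_ge0 eE lerXn2r// ?nnegrE ?expR_ge0//.
  exact: expR_ge1Dx.
rewrite ler_pdivrMr// (_ : _ / n%:R * s = expR (- s) * (n%:R * (s / n%:R) ^+ 2)); last first.
  by field; rewrite gt_eqF.
suff : expR (- s) * (1 - n%:R * (s / n%:R) ^+ 2) <= q n s ^+ n.
  by rewrite mulrBr mulr1; lra.
apply: (@le_trans _ _ (expR (- s) * (1 - (s / n%:R) ^+ 2) ^+ n)).
  by rewrite ler_wpM2l ?expR_ge0// bernoulli_expr// exprn_ile1.
rewrite eE -exprMn lerXn2r ?nnegrE//.
  by rewrite mulr_ge0 ?expR_ge0// subr_ge0 exprn_ile1.
rewrite /q; move: (s / n%:R) t0 t1 => t t0 t1.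
rewrite (_ : 1 - t ^+ 2 = (1 + t) * (1 - t)); last by ring.
rewrite mulrA ler_piMl ?subr_ge0//.
by rewrite expRN mulrC ler_pdivrMr ?expR_gt0// mul1r expR_ge1Dx.
Qed.

Let is_derive_Q n s : (0 < n)%N ->
  is_derive s 1 (fun s => - ((s + 1) * expR (- s)) / n%:R) (s * expR (- s) / n%:R).
Proof.
move=> n0; have N0 : n%:R != 0 :> R by rewrite pnatr_eq0 -lt0n.
have de : is_derive s 1 (fun s => expR (- s)) (- expR (- s)).
  apply: is_derive_congr (is_derive1_comp (is_derive_expR (- s)) (is_deriveN (is_derive_id s (1 : R)))) _ _ => //.
  by rewrite mulrN1.
have -> : (fun s => - ((s + 1) * expR (- s)) / n%:R) =
    (- n%:R^-1) *: ((id + cst 1) * (fun s => expR (- s))).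
  by apply/funext => t; rewrite !fctE /= /GRing.scale/= mulrC mulrN mulNr.
by apply: is_derive_eq; rewrite /GRing.scale/= !fctE /= addr0; field.
Qed.

(** Since p_n(n) = u_n + ln n, the quantity u_n + g(z) is the sum of E1(n), the increment of p_n - g
    over [z, n], and p_n(z). These lie in [0, 1/n], [0, 1/n] and [0, z]; the increment is controlled
    by [Q], which rises by at most 1/n. *)
Let u_expint1_bounds n z : (0 < n)%N -> 0 < z -> z <= n%:R ->
  0 <= u n + g z <= z + 2 / n%:R.
Proof.
move=> n0 z0 zn; have N0 : 0 < n%:R :> R by rewrite ltr0n.
have zsn s : z <= s <= n%:R -> 0 < s <= n%:R.
  by move=> /andP[zs ->]; rewrite (lt_le_trans z0).
have s_gt0 s : z <= s <= n%:R -> 0 < s by move=> /zsn/andP[].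
pose D' s := (1 - q n s ^+ n) / s - (1 - expR (- s)) / s.
have dD s : 0 < s -> is_derive s 1 (p n - g) (D' s).
  by move=> s0; apply: is_deriveB; [exact: is_derive_p|exact: is_derive_g].
pose Q s := - ((s + 1) * expR (- s)) / n%:R.
have dQ s : is_derive s 1 Q (s * expR (- s) / n%:R) by exact: is_derive_Q.
have D'0 s : z <= s <= n%:R -> 0 <= D' s <= s * expR (- s) / n%:R.
  by move=> /zsn; exact: derive_bounds.
have le1 : (p n - g) z <= (p n - g) n%:R.
  apply: (ge0_is_derive_le _ D' _ _ zn) => s zsN; first exact/dD/s_gt0.
  by have /andP[] := D'0 _ zsN.
have le2 : (Q - (p n - g)) z <= (Q - (p n - g)) n%:R.
  apply: (ge0_is_derive_le _ (fun s => s * expR (- s) / n%:R - D' s) _ _ zn) => s zsN.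
    by apply: is_deriveB; exact/dD/s_gt0.
  by have /andP[_] := D'0 _ zsN; rewrite subr_ge0.
have pn : p n n%:R = u n + ln n%:R.
  rewrite /u subrK big_add1/= big_mkord; apply: eq_bigr => k _.
  by rewrite /q divff ?gt_eqF// subrr expr0n/= subr0 mul1r.
have En := expint1_le n%:R N0.
have En0 := @expint1_ge0 R n%:R.
have /andP[pz0 pz] : 0 <= p n z <= z by rewrite p_bounds// z0.
have eN : expR (- n%:R) / n%:R <= n%:R^-1 :> R.
  by rewrite ler_piMl// ?invr_ge0// ?ltW// -expR0 ler_expR; lra.
have Qz : - n%:R^-1 <= Q z.
  rewrite /Q mulNr lerN2 ler_piMl ?invr_ge0 ?(ltW N0)//.
  by rewrite expRN ler_pdivrMr ?expR_gt0// mul1r addrC expR_ge1Dx.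
have QN : Q n%:R <= 0.
  by rewrite /Q mulNr oppr_le0 !mulr_ge0 ?expR_ge0 ?invr_ge0 ?addr_ge0 ?ltW.
have En1 := le_trans En eN.
move: le1 le2 Qz QN; rewrite !fctE /= pn /g.
move: {D' dD dQ D'0 zsn s_gt0 pn En eN} (u n) (Q z) (Q n%:R) (p n z) (expint1 z) (ln z) (expint1 n%:R)
  (ln n%:R) (n%:R^-1) En1 En0 pz0 pz => *.
by apply/andP; split; lra.
Qed.

(** The step is 1 / (n + 2) <= ln (n + 2) - ln (n + 1). The index is shifted because [ln 0] is 0:
    u_0 = 0 lies below u_1 = 1, and the decrease starts at index 1. *)
Let u_decr : {homo (fun n => u n.+1) : n m / (n <= m)%N >-> m <= n}.
Proof.
apply/nonincreasing_seqP => n; rewrite /u [X in X - _]big_nat_recr//=.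
have n0 : 0 < n.+1%:R :> R by [].
have n1 : 0 < n.+2%:R :> R by [].
suff : n.+2%:R^-1 <= ln n.+2%:R - ln n.+1%:R :> R.
  move: (n.+2%:R^-1) (ln n.+2%:R) (ln n.+1%:R) (\sum_(_ <= _ < _) _) => *; lra.
rewrite -ln_div ?posrE// -[_ / _]invrK lnV ?posrE ?divr_gt0// ?invr_gt0// ?divr_gt0//.
rewrite invf_div lerNr.
rewrite (_ : n.+1%:R / n.+2%:R = 1 + (- n.+2%:R^-1) :> R); last first.
  rewrite -[X in _ = X - _](@divff _ n.+2%:R) ?gt_eqF// -[X in _ - X]mul1r -mulrBl.
  by congr (_ / _); rewrite -[n.+2%:R]natr1 addrK.
apply: le_ln1Dx; rewrite ltrN2 invf_lt1// ltr1n//.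
Qed.

Let cvg_u : u n.+1 @[n --> \oo] --> euler_gamma R.
Proof.
have cu : cvgn (fun n => u n.+1).
  apply: nonincreasing_is_cvgn; first exact: u_decr.
  exists (- g 1) => _ [n _ <-].
  have /andP[] : 0 <= u n.+1 + g 1 <= 1 + 2 / n.+1%:R.
    by apply: u_expint1_bounds; rewrite ?ler1n.
  by move: (u n.+1) (g 1) => *; lra.
suff -> : euler_gamma R = limn (fun n => u n.+1) by [].
rewrite -[LHS]/(limn u); apply/cvg_lim => //.
by move: cu; rewrite (@cvg_shiftS R^o).
Qed.

Lemma euler_gamma_expint1 z : 0 < z -> 0 <= euler_gamma R + expint1 z + ln z <= z.
Proof.
move=> z0.
have zn : \forall n \near \oo, z <= n.+1%:R.
  near=> n; apply: (@le_trans _ _ n%:R); last by rewrite ler_nat.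
  by near: n; exact: nbhs_infty_ger.
have lo : - g z <= euler_gamma R.
  apply: ler_cvg_to (cvg_cst _) cvg_u _; apply: filterS zn => n zn.
  have /andP[] := u_expint1_bounds n.+1 z isT z0 zn.
  by move: (u n.+1) (g z) (n.+1%:R^-1) => *; lra.
have hi : euler_gamma R <= z - g z + 2 * 0.
  have c2 : z - g z + 2 * n.+1%:R^-1 @[n --> \oo] --> z - g z + 2 * 0.
    by apply: cvgD; [exact: cvg_cst|apply: cvgM; [exact: cvg_cst|exact: cvg_harmonic]].
  apply: ler_cvg_to cvg_u c2 _; apply: filterS zn => n zn.
  have /andP[] := u_expint1_bounds n.+1 z isT z0 zn.
  by move: (u n.+1) (g z) (n.+1%:R^-1) => *; lra.
by move: lo hi; rewrite /g => lo hi; apply/andP; split; lra.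
Unshelve. all: by end_near. Qed.

End euler_gamma_expint1.

(** * Tonelli on rectangles, the Gamma integral and the Mellin transform of the exponential *)

Section mellin.
Context {R : realType}.
Notation mu := (@lebesgue_measure R).

(** Extension by zero reduces the claim to the whole plane. Measurability is asked on the rectangle
    only, which fits factors such as 1 / t or E1 (w u). *)
Lemma tonelli_prod (D1 D2 : set R) (f : R * R -> R) :
  measurable D1 -> measurable D2 -> measurable_fun (D1 `*` D2) f ->
  (forall x, (D1 `*` D2) x -> 0 <= f x) ->
  (\int[mu]_(x in D1) \int[mu]_(y in D2) (f (x, y))%:E =
   \int[mu]_(y in D2) \int[mu]_(x in D1) (f (x, y))%:E)%E.
Proof.
move=> mD1 mD2 mf f0.
pose h : R * R -> \bar R := (EFin \o f) \_ (D1 `*` D2).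
have mh : measurable_fun setT h.
  by apply/(measurable_restrictT _ (measurableX mD1 mD2))/measurable_EFinP.
have h0 z : (0 <= h z)%E.
  by apply: erestrict_ge0 => {}z Dz; rewrite lee_fin f0.
have h1 x : ((fun x => \int[mu]_(y in D2) (f (x, y))%:E)%E \_ D1) x =
    (\int[mu]_y h (x, y))%E.
  rewrite patchE; case: ifPn => xD.
    rewrite integral_mkcond; apply: eq_integral => y _.
    by rewrite /h !patchE in_setX xD.
  by rewrite integral0_eq// => y _; rewrite /h patchE in_setX (negbTE xD).
have h2 y : ((fun y => \int[mu]_(x in D1) (f (x, y))%:E)%E \_ D2) y =
    (\int[mu]_x h (x, y))%E.
  rewrite patchE; case: ifPn => yD.
    rewrite integral_mkcond; apply: eq_integral => x _.
    by rewrite /h !patchE in_setX yD andbT.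
  by rewrite integral0_eq// => x _; rewrite /h patchE in_setX (negbTE yD) andbF.
transitivity (\int[mu]_x \int[mu]_y h (x, y))%E.
  by rewrite integral_mkcond; apply: eq_integral => x _; exact: h1.
transitivity (\int[mu]_y \int[mu]_x h (x, y))%E.
  exact: (fubini_tonelli (h : measurableTypeR R * measurableTypeR R -> \bar R) mh h0).
by rewrite [RHS]integral_mkcond; apply: eq_integral => y _; rewrite -h2.
Qed.

Lemma integral_powR_itv0c (x b : R) : 0 < x -> 0 < b ->
  (\int[mu]_(u in `]0%R, b]) (x * u `^ (x - 1))%:E = (b `^ x)%:E)%E.
Proof.
move=> x0 b0; apply: ge0_FTC2_at0 => //.
- by move=> u _; rewrite mulr_ge0 ?powR_ge0// ltW.
- move=> u u0; apply: continuousM; first exact: cst_continuous.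
  exact: is_derive_continuous (is_derive1_powR _ u0).
- exact: powR_cvg0.
Qed.

(** t^x <= max(1, t) <= 2 (1 + t / 2) <= 2 e^(t / 2), a majorant free of x. *)
Lemma Gamma_integrand_le (x t : R) : 0 < x <= 1 -> 0 < t ->
  t `^ x * expR (- t) <= 2 * expR (- (2^-1 * t)).
Proof.
move=> /andP[x0 x1] t0.
have tx : t `^ x <= 2 * expR (2^-1 * t).
  have := expR_ge1Dx (2^-1 * t); have [t1|t1] := leP t 1.
    have : t `^ x <= 1 `^ x by apply: ge0_ler_powR; rewrite ?nnegrE// ltW.
    rewrite powR1.
    lra.
  by have : t `^ x <= t := ler1_powR (ltW t1) x1; lra.
apply: le_trans (ler_wpM2r (expR_ge0 _) tx) _.
rewrite -mulrA -expRD ler_wpM2l// ler_expR; lra.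
Qed.

Lemma measurable_Gamma_integrand (x : R) (D : set R) :
  measurable_fun D (fun t : R => t `^ x * expR (- t)).
Proof.
apply: measurable_funTS; apply: measurable_funM.
  exact: measurable_powR.
by apply: measurableT_comp => //; exact: oppr_measurable.
Qed.

Lemma integrable_Gamma (x : R) : 0 < x <= 1 ->
  mu.-integrable `]0, +oo[ (EFin \o (fun t : R => t `^ x * expR (- t))).
Proof.
move=> x01.
have : mu.-integrable `]0, +oo[
    (EFin \o (fun t : R => 2 * expR (- (2^-1 * t)))).
  apply: (@integrableS _ _ _ mu `[0, +oo[) => //.
    by apply: subset_itvr; rewrite bnd_simp.
  by apply: (integrableZl _ _ (integrable_expR_itvy 2^-1 0 _)).
apply: le_integrable => //.
  by apply/measurable_EFinP; exact: measurable_Gamma_integrand.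
move=> t /=; rewrite in_itv/= andbT => t0; rewrite lee_fin !ger0_norm.
- exact: Gamma_integrand_le.
- by rewrite mulr_ge0 ?expR_ge0.
- by rewrite mulr_ge0 ?expR_ge0 ?powR_ge0.
Qed.

Lemma Gamma_integralE (x : R) : 0 < x <= 1 ->
  (\int[mu]_(t in `]0%R, +oo[) (t `^ x * expR (- t))%:E = (Gamma (x + 1))%:E)%E.
Proof.
move=> x01; rewrite /Gamma addrK /Rintegral fineK//.
exact/integrable_fin_num/integrable_Gamma.
Qed.

(** On [1, +oo[ one has t^x >= 1, and e^(-1) is the integral of e^(-t) there. *)
Lemma Gamma_ge (x : R) : 0 < x <= 1 -> expR (- 1) <= Gamma (x + 1).
Proof.
move=> x01; rewrite -lee_fin -Gamma_integralE//.
rewrite -[in leLHS](divr1 (expR _)) -[X in - X](mulr1 1) -integral_expR_itvy//.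
apply: (@le_trans _ _ (\int[mu]_(t in `[1%R, +oo[) (t `^ x * expR (- t))%:E)%E).
  apply: ge0_le_integral => //.
  - by apply/measurable_EFinP; exact: measurable_expR_mul.
  - by apply/measurable_EFinP; exact: measurable_Gamma_integrand.
  move=> t /=; rewrite in_itv/= andbT mul1r => t1; rewrite lee_fin.
  rewrite ler_peMl ?expR_ge0//.
  rewrite [leLHS](_ : 1 = 1 `^ x); last by rewrite powR1.
  apply: ge0_ler_powR; rewrite ?nnegrE//.
  - by case/andP: x01 => /ltW.
  - by rewrite (le_trans _ t1).
apply: ge0_subset_integral => //.
- by apply/measurable_EFinP; exact: measurable_Gamma_integrand.
- by move=> t _; rewrite lee_fin mulr_ge0 ?expR_ge0 ?powR_ge0.
- by apply: subset_itvr; rewrite bnd_simp.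
Qed.

(* Tonelli on [0 < A u < s]: integrating [x u ^ (x - 1) e ^ (- s)] first in [s]
   gives the left-hand side, first in [u] the right-hand side. *)
Lemma mellin_expR (x A : R) : 0 < x <= 1 -> 0 < A ->
  (\int[mu]_(u in `]0%R, +oo[) (x * u `^ (x - 1) * expR (- (A * u)))%:E =
   (Gamma (x + 1) / A `^ x)%:E)%E.
Proof.
move=> x01 A0; have /andP[x0 _] := x01.
pose f (z : R * R) : R := if A * z.1 < z.2 then x * z.1 `^ (x - 1) * expR (- z.2) else 0.
have mf : measurable_fun setT f.
  apply: measurable_fun_ifT => //.
    apply: measurable_fun_ltr => //; apply: measurable_funM => //.
  apply: measurable_funM; first apply: measurable_funM => //.
    apply: (measurableT_comp (f := fun u : R => u `^ (x - 1))) => //.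
  by apply: measurableT_comp => //; apply: measurable_funN.
have f0 z : 0 <= f z.
  by rewrite /f; case: ifP => // _; rewrite !mulr_ge0 ?expR_ge0 ?powR_ge0 ?ltW.
transitivity (\int[mu]_(u in `]0%R, +oo[) \int[mu]_(s in `]0%R, +oo[) (f (u, s))%:E)%E.
  apply: eq_integral => u; rewrite inE/= in_itv/= andbT => u0.
  have Au0 : 0 < A * u by rewrite mulr_gt0.
  rewrite [RHS](_ : _ = \int[mu]_(s in `](A * u)%R, +oo[)
      ((x * u `^ (x - 1))%:E * (expR (- (1 * s)))%:E))%E; last first.
    rewrite [LHS]integral_mkcond [RHS]integral_mkcond; apply: eq_integral => s _.
    rewrite !patchE !mem_setE/= !in_itv/= !andbT /f/= mul1r.
    have [us|us] := ltP (A * u) s; first by rewrite (lt_trans Au0 us).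
    by case: ifP.
  rewrite ge0_integralZl_EFin//.
  - rewrite integral_itv_obnd_cbnd; last first.
      by apply/measurable_EFinP; exact: measurable_expR_mul.
    by rewrite integral_expR_itvy// mul1r divr1.
  - by apply/measurable_EFinP; exact: measurable_expR_mul.
  - by rewrite mulr_ge0 ?powR_ge0// ltW.
rewrite tonelli_prod//; last exact: measurable_funTS.
transitivity (\int[mu]_(s in `]0%R, +oo[) ((A `^ x)^-1%:E * (s `^ x * expR (- s))%:E))%E.
  apply: eq_integral => s; rewrite inE/= in_itv/= andbT => s0.
  have sA0 : 0 < s / A by rewrite divr_gt0.
  rewrite [LHS](_ : _ = \int[mu]_(u in `]0%R, (s / A)%R[)
      ((expR (- s))%:E * (x * u `^ (x - 1))%:E))%E; last first.
    rewrite [LHS]integral_mkcond [RHS]integral_mkcond; apply: eq_integral => u _.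
    rewrite !patchE !mem_setE/= !in_itv/= !andbT /f/= ltr_pdivlMr// (mulrC u).
    by case: ifP => //= u0; case: ifP => // us; rewrite -EFinM mulrC.
  have mp D : measurable_fun D (fun u : R => (x * u `^ (x - 1))%:E).
    apply: measurable_funTS; apply/measurable_EFinP; apply: measurable_funM => //.
  rewrite ge0_integralZl_EFin ?expR_ge0//.
  - rewrite integral_itv_bndo_bndc// integral_powR_itv0c// -!EFinM; congr EFin.
    rewrite powRM ?invr_ge0 ?(ltW A0) ?(ltW s0)//.
    rewrite -(powR_inv1 (ltW A0)) -powRrM mulN1r powRN; ring.
  - by move=> u _; rewrite lee_fin mulr_ge0 ?powR_ge0// ltW.
  - exact: mp.
rewrite ge0_integralZl_EFin ?invr_ge0 ?powR_ge0//.
- by rewrite Gamma_integralE// -EFinM mulrC.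
- by move=> t _; rewrite lee_fin mulr_ge0 ?expR_ge0 ?powR_ge0.
- by apply/measurable_EFinP; exact: measurable_Gamma_integrand.
Qed.

End mellin.

(** * Reduction of the r-fold integral to a single integral in u *)

Section iterated_integral.
Context {R : realType}.
Notation mu := (@lebesgue_measure R).

Definition mellin_integrand {r : nat} (omega : r.-tuple R) (x a u : R) : R :=
  x * u `^ (x - 1) * expR (- (a * u)) * \prod_(i < r) expint1 (tnth omega i * u).

Lemma mellin_integrand_ge0 r (omega : r.-tuple R) x a u : 0 <= x ->
  0 <= mellin_integrand omega x a u.
Proof.
move=> x0; rewrite /mellin_integrand !mulr_ge0 ?powR_ge0 ?expR_ge0//.
by apply: prodr_ge0 => i _; exact: expint1_ge0.
Qed.

Lemma continuous_expint1_mul (w u : R) : 0 < w -> 0 < u ->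
  {for u, continuous (fun u => expint1 (w * u))}.
Proof.
move=> w0 u0; apply: continuous_comp; first exact: mulrl_continuous.
by apply: is_derive_continuous (is_derive_expint1 _ _); rewrite mulr_gt0.
Qed.

Lemma measurable_expint1_prod r (omega : r.-tuple R) :
  (forall i, 0 < tnth omega i) ->
  measurable_fun (`]0, +oo[ : set R)
    (fun u => \prod_(i < r) expint1 (tnth omega i * u)).
Proof.
move=> w0; apply: (measurable_prod (s := index_enum 'I_r)
  (h := fun i u => expint1 (tnth omega i * u))) => i _.
apply: open_continuous_measurable_fun => // u.
by rewrite inE/= in_itv/= andbT => u0; exact: continuous_expint1_mul.
Qed.

Lemma measurable_mellin_integrand r (omega : r.-tuple R) x a :
  (forall i, 0 < tnth omega i) ->
  measurable_fun (`]0, +oo[ : set R) (mellin_integrand omega x a).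
Proof.
move=> w0; apply: measurable_funM; last exact: measurable_expint1_prod.
apply: measurable_funM; last exact: measurable_expR_mul.
by apply: measurable_funM => //; exact: measurable_funTS (measurable_powR _).
Qed.

(** Generalized for induction on r: [p] collects the variables already fixed and [a] absorbs their
    contribution w t to the linear form. Exchanging t and u then produces the factor E1 (w u). The
    base case is [mellin_expR] at A = a and fails for a = 0; the disjunction survives because w t +
    a > 0 once a variable has been peeled off. *)
Lemma iterated_integral_mellin r (omega : r.-tuple R) (x p a : R) :
  (forall i, 0 < tnth omega i) -> 0 < x <= 1 -> 0 < p -> 0 <= a ->
  0 < a \/ (0 < r)%N ->
  (iterated_integral1y (fun t : r.-tuple R =>
    (p * (\prod_(i < r) tnth t i *
      (\sum_(i < r) tnth omega i * tnth t i + a) `^ x))^-1%:E) =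
  (p * Gamma (x + 1))^-1%:E *
    \int[mu]_(u in `]0%R, +oo[) (mellin_integrand omega x a u)%:E)%E.
Proof.
move=> + x01; have x0 : 0 <= x by case/andP: x01 => /ltW.
have G0 : 0 < Gamma (x + 1) by apply: lt_le_trans (Gamma_ge _ x01); exact: expR_gt0.
elim: r omega p a => [omega p a _ p0 _ [a0|//]|r ih omega p a].
  rewrite /= !big_ord0 add0r mul1r.
  under eq_integral do rewrite /mellin_integrand big_ord0 mulr1.
  rewrite mellin_expR// -EFinM; congr EFin.
  by field; rewrite !gt_eqF// powR_gt0.
case/tupleP : omega => w omega w0 p0 a0 _.
have {}w0 : 0 < w /\ forall i, 0 < tnth omega i.
  split; first by have := w0 ord0; rewrite tnth0.
  by move=> i; have := w0 (lift ord0 i); rewrite tnthS.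
have [w_gt0 omega_gt0] := w0.
pose f (z : R * R) := (p * Gamma (x + 1))^-1 *
  (mellin_integrand omega x a z.2 * (expR (- (w * z.2 * z.1)) / z.1)).
transitivity (\int[mu]_(t in `[1%R, +oo[) \int[mu]_(u in `]0%R, +oo[) (f (t, u))%:E)%E.
  apply: eq_integral => t; rewrite inE/= in_itv/= andbT => t1.
  have t0 : 0 < t by rewrite (lt_le_trans _ t1).
  have wta : 0 < w * t + a by rewrite ltr_pwDl// mulr_gt0.
  transitivity (iterated_integral1y (fun s : r.-tuple R =>
    (p * t * (\prod_(i < r) tnth s i *
      (\sum_(i < r) tnth omega i * tnth s i + (w * t + a)) `^ x))^-1%:E)).
    congr iterated_integral1y; apply/funext => s.
    rewrite !big_ord_recl !tnth0; congr (_^-1%:E).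
    under eq_bigr do rewrite tnthS.
    have -> : \sum_(i < r) tnth [tuple of w :: omega] (lift ord0 i) *
        tnth [tuple of t :: s] (lift ord0 i) = \sum_(i < r) tnth omega i * tnth s i.
      by apply: eq_bigr => i _; rewrite !tnthS.
    by rewrite -!mulrA; congr (_ * (_ * (_ * _ `^ _))); ring.
  rewrite ih ?mulr_gt0//; [|exact: ltW|by left].
  rewrite -ge0_integralZl_EFin//; last 3 first.
  - by move=> u _; rewrite lee_fin mellin_integrand_ge0.
  - by apply/measurable_EFinP; exact: measurable_mellin_integrand.
  - by rewrite invr_ge0 ltW// !mulr_gt0.
  apply: eq_integral => u _; rewrite -EFinM; congr EFin.
  rewrite /f /mellin_integrand/= (_ : - ((w * t + a) * u) = - (a * u) - w * u * t).
    by rewrite expRD; field; rewrite !gt_eqF.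
  by ring.
have k0 : 0 <= (p * Gamma (x + 1))^-1 by rewrite invr_ge0 ltW// mulr_gt0.
have m2 : measurable_fun (`[1, +oo[ `*` `]0, +oo[ : set (R * R))
    (fun z => mellin_integrand omega x a z.2).
  apply: (@measurable_comp _ _ _ _ _ _ (`]0, +oo[ : set R)) => //.
  - by move=> _ [z [_ z2] <-].
  - exact: measurable_mellin_integrand.
  - exact: measurable_funTS measurable_snd.
rewrite tonelli_prod//; last 2 first.
- apply: measurable_funM => //; apply: measurable_funM => //.
  apply: measurable_funM.
    apply: measurable_funTS; apply: measurableT_comp => //; apply: measurable_funN.
    by apply: measurable_funM => //; apply: measurable_funM.
  apply: (@measurable_comp _ _ _ _ _ _ (`[1, +oo[ : set R)) => //.
  + by move=> _ [z [z1 _] <-].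
  + exact: measurable_inv_itv1y.
  + exact: measurable_funTS measurable_fst.
- move=> z [/=]; rewrite in_itv/= andbT => z1 _.
  have z10 := le_trans ler01 z1.
  by rewrite /f mulr_ge0// mulr_ge0 ?mellin_integrand_ge0// divr_ge0 ?expR_ge0.
rewrite -ge0_integralZl_EFin//; last 2 first.
- by move=> u _; rewrite lee_fin mellin_integrand_ge0.
- apply/measurable_EFinP; apply: measurable_mellin_integrand => i.
  by case: (unliftP ord0 i) => [j|] ->; rewrite ?tnthS ?tnth0.
apply: eq_integral => u; rewrite inE/= in_itv/= andbT => u0.
rewrite [LHS](_ : _ = \int[mu]_(t in `[1%R, +oo[)
    (((p * Gamma (x + 1))^-1 * mellin_integrand omega x a u)%:E *
     (expR (- (w * u * t)) / t)%:E))%E; last first.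
  by apply: eq_integral => t _; rewrite -EFinM /f/= !mulrA.
rewrite ge0_integralZl_EFin//; last 3 first.
- move=> t; rewrite /= in_itv/= andbT => t1.
  by rewrite lee_fin divr_ge0 ?expR_ge0// (le_trans _ t1).
- have := integrable_expint1 (w * u); rewrite mulr_gt0// => /(_ isT).
  exact: measurable_int.
- by rewrite mulr_ge0 ?mellin_integrand_ge0.
rewrite expint1E ?mulr_gt0// -!EFinM; congr EFin.
rewrite /mellin_integrand big_ord_recl tnth0.
under [in RHS]eq_bigr do rewrite tnthS.
by ring.
Qed.

Lemma Ir_mellin r (omega : r.-tuple R) (x a : R) : (0 < r)%N ->
  (forall i, 0 < tnth omega i) -> 0 < x <= 1 -> 0 <= a ->
  Ir x omega a = (Gamma (x + 1))^-1 *
    \int[mu]_(u in `]0, +oo[) mellin_integrand omega x a u.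
Proof.
move=> r0 w0 x01 a0; rewrite /Ir /Ir_ext.
have := @iterated_integral_mellin r omega x 1 a w0 x01 ltr01 a0 (or_intror r0).
under [X in iterated_integral1y X]funext do rewrite mul1r.
move=> ->; rewrite mul1r.
have : (0 <= \int[mu]_(u in `]0%R, +oo[) (mellin_integrand omega x a u)%:E)%E.
  apply: integral_ge0 => u _; rewrite lee_fin mellin_integrand_ge0//.
  by case/andP: x01 => /ltW.
(* If the integral were +oo, [fine] would send both sides to 0, so the identity can precede any
   proof of convergence. *)
rewrite /Rintegral; case: (integral _ _ _) => [s| |] // _.
rewrite mulr0 mulry gtr0_sg ?mul1e// invr_gt0.
by apply: lt_le_trans (Gamma_ge _ x01); exact: expR_gt0.
Qed.

End iterated_integral.

(** * Functions growing more slowly than every negative power at 0 *)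

Section subpolynomial.
Context {R : realType}.
Implicit Types (c d : R) (f g h : R -> R).

(** Quantifying over all d makes the class stable under products, by splitting d in halves; a bound
    with one fixed exponent would degrade with each factor. The estimate covers all of ]0, c] so
    that it can be integrated there. *)
Definition subpolynomial_at0 c h := forall d, 0 < d ->
  exists C, forall u : R, 0 < u <= c -> `|h u| <= C * u `^ (- d).

Lemma subpolynomial_at0_bounded c h K :
  (forall u : R, 0 < u <= c -> `|h u| <= K) -> subpolynomial_at0 c h.
Proof.
move=> hK d d0; exists (K * c `^ d) => u /andP[u0 uc].
have K0 : 0 <= K by apply: le_trans (hK u _); rewrite ?u0.
have ud : u `^ d <= c `^ d.
  by apply: ge0_ler_powR => //; rewrite ?nnegrE ltW// (lt_le_trans u0).
apply: (@le_trans _ _ (K * 1)); first by rewrite mulr1 hK// u0.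
by rewrite -mulrA ler_wpM2l// powRN ler_pdivlMr ?powR_gt0// mul1r.
Qed.

Lemma subpolynomial_at0_cst c k : subpolynomial_at0 c (cst k).
Proof. exact: (@subpolynomial_at0_bounded _ _ `|k|). Qed.

Lemma subpolynomial_at0D c f g : subpolynomial_at0 c f ->
  subpolynomial_at0 c g -> subpolynomial_at0 c (fun u => f u + g u).
Proof.
move=> bf bg d d0; have [C fC] := bf d d0; have [C' gC'] := bg d d0.
exists (C + C') => u uc; rewrite mulrDl (le_trans (ler_normD _ _))//.
by rewrite lerD ?fC ?gC'.
Qed.

Lemma subpolynomial_at0M c f g : subpolynomial_at0 c f ->
  subpolynomial_at0 c g -> subpolynomial_at0 c (fun u => f u * g u).
Proof.
move=> bf bg d d0; have d2 : 0 < d / 2 by rewrite divr_gt0.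
have [C fC] := bf _ d2; have [C' gC'] := bg _ d2.
exists (C * C') => u uc; have u0 : 0 < u by case/andP: uc.
have -> : u `^ (- d) = u `^ (- (d / 2)) * u `^ (- (d / 2)).
  by rewrite -powRD ?(gt_eqF u0) ?implybT//; congr (_ `^ _); field.
by rewrite mulrACA normrM ler_pM ?fC ?gC'.
Qed.

Lemma subpolynomial_at0X c f n : subpolynomial_at0 c f ->
  subpolynomial_at0 c (fun u => f u ^+ n).
Proof.
move=> bf; elim: n => [|n ih].
  by apply: (@subpolynomial_at0_bounded _ _ 1) => u _; rewrite expr0 normr1.
by under eq_fun do rewrite exprS; exact: subpolynomial_at0M.
Qed.

Lemma subpolynomial_at0_ln c : subpolynomial_at0 c (@ln R).
Proof.
move=> d d0.
have [C hC] := subpolynomial_at0_cst c (ln c) d d0.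
exists (C + d^-1) => u ucc; have /andP[u0 uc] := ucc.
have := hC u ucc; rewrite /= mulrDl => hc.
(* This is ln y < y at y = u^(-d); large positive values of ln u are excluded by u <= c. *)
have h1 : - ln u <= d^-1 * u `^ (- d).
  rewrite mulrC ler_pdivlMr//.
  have := ln_sublinear (powR_gt0 (- d) u0); rewrite ln_powR => /ltW; lra.
have h2 : ln u <= `|ln c|.
  apply: le_trans (ler_norm _); rewrite ler_ln ?posrE//.
  exact: lt_le_trans uc.
have h3 : 0 <= d^-1 * u `^ (- d) by rewrite mulr_ge0 ?invr_ge0 ?powR_ge0// ltW.
have hn := normr_ge0 (ln c).
rewrite ler_norml; apply/andP; split; first lra.
by apply: le_trans h2 _; lra.
Qed.

Lemma subpolynomial_at0_prod (I : Type) (s : seq I) (F : I -> R -> R) c :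
  (forall i, subpolynomial_at0 c (F i)) ->
  subpolynomial_at0 c (fun u => \prod_(i <- s) F i u).
Proof.
move=> bF; elim: s => [|i s ih].
  by apply: (@subpolynomial_at0_bounded _ _ 1) => u _; rewrite big_nil normr1.
by under eq_fun do rewrite big_cons; exact: subpolynomial_at0M.
Qed.

(** Telescoping, one factor at a time: F P - G Q = (F - G) P + G (P - Q). *)
Lemma subpolynomial_at0_prodB (I : Type) (s : seq I) (F G : I -> R -> R) c :
  (forall i, subpolynomial_at0 c (F i)) ->
  (forall i, subpolynomial_at0 c (G i)) ->
  (forall i, subpolynomial_at0 c (fun u => (F i u - G i u) / u)) ->
  subpolynomial_at0 c
    (fun u => (\prod_(i <- s) F i u - \prod_(i <- s) G i u) / u).
Proof.
move=> bF bG bFG; elim: s => [|i s ih].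
  apply: (@subpolynomial_at0_bounded _ _ 0) => u _.
  by rewrite !big_nil subrr mul0r normr0.
rewrite (_ : (fun u => _) = (fun u => (F i u - G i u) / u * \prod_(i <- s) F i u +
    G i u * ((\prod_(i <- s) F i u - \prod_(i <- s) G i u) / u))); last first.
  by apply/funext => u; rewrite !big_cons; ring.
apply: subpolynomial_at0D; apply: subpolynomial_at0M => //.
exact: subpolynomial_at0_prod.
Qed.

End subpolynomial.

(** * Replacing E1 by its logarithmic asymptotics *)

Definition expint1_asym {R : realType} (w u : R) : R :=
  - euler_gamma R - ln (w * u).

Section remainder.
Context {R : realType}.
Notation mu := (@lebesgue_measure R).
Notation gamma := (euler_gamma R).


Lemma expint1_asym_bound (w u : R) : 0 < w -> 0 < u ->
  `|expint1 (w * u) - expint1_asym w u| <= w * u.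
Proof.
move=> w0 u0; have wu0 := mulr_gt0 w0 u0.
have /andP[h1 h2] := euler_gamma_expint1 _ wu0.
by rewrite ger0_norm /expint1_asym; lra.
Qed.

Lemma subpolynomial_asym c (w : R) : 0 < w -> subpolynomial_at0 c (expint1_asym w).
Proof.
move=> w0 d d0.
have [C hC] := subpolynomial_at0D _ _ _
  (subpolynomial_at0_cst c (- gamma - ln w))
  (subpolynomial_at0M _ _ _ (subpolynomial_at0_cst c (- 1))
    (subpolynomial_at0_ln c)) d d0.
exists C => u uc; have u0 : 0 < u by case/andP: uc.
apply: le_trans (hC u uc); rewrite /expint1_asym lnM ?posrE// le_eqVlt; apply/orP; left.
by apply/eqP; congr `| _ |; rewrite /=; ring.
Qed.

Lemma subpolynomial_expint1B_asym c (w : R) : 0 < w ->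
  subpolynomial_at0 c (fun u => (expint1 (w * u) - expint1_asym w u) / u).
Proof.
move=> w0; apply: (@subpolynomial_at0_bounded _ _ _ w) => u /andP[u0 uc].
by rewrite normf_div (gtr0_norm u0) ler_pdivrMr// expint1_asym_bound.
Qed.

Lemma subpolynomial_expint1 c (w : R) : 0 < w ->
  subpolynomial_at0 c (fun u => expint1 (w * u)).
Proof.
move=> w0.
have : subpolynomial_at0 c (fun u => expint1_asym w u + (expint1 (w * u) - expint1_asym w u)).
  apply: subpolynomial_at0D; first exact: subpolynomial_asym.
  apply: (@subpolynomial_at0_bounded _ _ _ (w * c)) => u /andP[u0 uc].
  by apply: le_trans (expint1_asym_bound _ _ w0 u0) _; rewrite ler_pM2l.
by under eq_fun do rewrite addrC subrK.
Qed.

(** The factor e^(-a u) is dropped together with the replacement of E1: it contributes (e^(-a u) -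
    1) / u, bounded by a, times the product of the E1. *)
Lemma subpolynomial_mellinB r (omega : r.-tuple R) (a c : R) :
  (forall i, 0 < tnth omega i) -> 0 <= a ->
  subpolynomial_at0 c (fun u => (expR (- (a * u)) *
    \prod_(i < r) expint1 (tnth omega i * u) - \prod_(i < r) expint1_asym (tnth omega i) u) / u).
Proof.
move=> w0 a0.
rewrite (_ : (fun u => _) = (fun u =>
    (expR (- (a * u)) - 1) / u * \prod_(i < r) expint1 (tnth omega i * u) +
    (\prod_(i < r) expint1 (tnth omega i * u) -
      \prod_(i < r) expint1_asym (tnth omega i) u) / u)); last by apply/funext => u; ring.
apply: subpolynomial_at0D; last first.
  apply: (subpolynomial_at0_prodB _ _ (fun i u => expint1 (tnth omega i * u))
    (fun i => expint1_asym (tnth omega i))) => i.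
  - exact: subpolynomial_expint1.
  - exact: subpolynomial_asym.
  - exact: subpolynomial_expint1B_asym.
apply: subpolynomial_at0M.
  apply: (@subpolynomial_at0_bounded _ _ _ a) => u /andP[u0 uc].
  rewrite normf_div (gtr0_norm u0) ler_pdivrMr// ler0_norm.
    by have := expR_ge1Dx (- (a * u)); lra.
  by rewrite subr_le0 -expR0 ler_expR oppr_le0 mulr_ge0// ltW.
by apply: (subpolynomial_at0_prod _ _ (fun i u => expint1 (tnth omega i * u))) => i;
  exact: subpolynomial_expint1.
Qed.

End remainder.

(** * The main term: symmetric functions and integrals of powers of logarithms *)

Section main_term.
Context {R : realType}.
Notation mu := (@lebesgue_measure R).

Lemma prod_subr_subsets (r : nat) (y : R) (b : 'I_r -> R) :
  \prod_(i < r) (y - b i) = \sum_(0 <= k < r.+1)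
    (-1) ^+ k * (\sum_(A : {set 'I_r} | #|A| == k) \prod_(i in A) b i) * y ^+ (r - k).
Proof.
under eq_bigr do rewrite addrC.
rewrite bigA_distr.
under eq_bigr => A _.
  rewrite (bigID (mem A))/=.
  rewrite (eq_bigr (fun i => - b i)); last by move=> i ->.
  rewrite [X in _ * X](eq_bigr (fun=> y)); last by move=> i /negbTE ->.
  rewrite prodrN prodr_const.
  rewrite [X in y ^+ X](_ : _ = (r - #|A|)%N); last first.
    apply: (@addnI #|A|); rewrite subnKC; last by rewrite -[leqRHS]card_ord max_card.
    by rewrite -[RHS]card_ord -(cardC A); congr addn; exact: eq_card.
  over.
(* Subsets are grouped by cardinality; [inord] loses nothing, since a subset has at most r
   elements. *)
rewrite big_mkord (partition_big (fun A : {set 'I_r} => inord #|A| : 'I_r.+1) predT)//=.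
apply: eq_bigr => k _; rewrite big_distrr big_distrl/=.
have cA (A : {set 'I_r}) : (inord #|A| == k) = (#|A| == k :> nat).
  by rewrite -val_eqE/= inordK// ltnS -[leqRHS]card_ord max_card.
by apply: eq_big => [A|A /eqP <-] //; rewrite inordK// ltnS -[leqRHS]card_ord max_card.
Qed.

(** Integrability and value are proved together: additivity at each step needs the partial sum to be
    integrable. *)
Lemma Rintegral_lincomb (D : set R) (n : nat) (k : nat -> R) (f : nat -> R -> R) :
  measurable D -> (forall i, mu.-integrable D (EFin \o f i)) ->
  mu.-integrable D (EFin \o (fun u => \sum_(0 <= i < n) k i * f i u)) /\
  \int[mu]_(u in D) (\sum_(0 <= i < n) k i * f i u) =
    \sum_(0 <= i < n) k i * \int[mu]_(u in D) f i u.
Proof.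
move=> mD fi; elim: n => [|n [ihi ih]].
  rewrite big_geq//; under eq_fun do rewrite big_geq//.
  by split; [exact: integrable0|rewrite Rintegral_cst// mul0r].
rewrite big_nat_recr//= -ih.
under eq_fun do rewrite big_nat_recr//=.
have kfi : mu.-integrable D (EFin \o (fun u => k n * f n u)).
  by apply: (integrableZl _ (k n) (fi n)).
split; first by apply: (integrableD _ ihi kfi).
by rewrite RintegralD// RintegralZl.
Qed.

Variable g : R.
Let c := expR (- g).
Let L (u : R) := - g - ln u.

Let L_ge0 (u : R) : 0 < u <= c -> 0 <= L u.
Proof.
move=> /andP[u0 uc]; rewrite /L subr_ge0 -[leRHS]expRK ler_ln ?posrE ?expR_gt0//.
Qed.

Let subpolynomial_LX m : subpolynomial_at0 c (fun u => L u ^+ m).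
Proof.
apply: subpolynomial_at0X.
rewrite (_ : L = fun u => cst (- g) u + cst (- 1) u * ln u); last first.
  by apply/funext => u; rewrite /L/= mulN1r.
apply: subpolynomial_at0D; first exact: subpolynomial_at0_cst.
apply: subpolynomial_at0M; first exact: subpolynomial_at0_cst.
exact: subpolynomial_at0_ln.
Qed.

Let is_derive_L (u : R) : 0 < u -> is_derive u 1 L (- u^-1).
Proof.
move=> u0; have := is_derive1_ln u0 => d.
have -> : L = cst (- g) - @ln R by [].
by apply: is_derive_eq; rewrite sub0r.
Qed.

Let cvg_powR_LX (x : R) m : 0 < x -> u `^ x * L u ^+ m @[u --> 0^'+] --> 0.
Proof.
(* One half of u^x absorbs the power of L, the other half tends to 0. *)
move=> x0; have x2 : 0 < x / 2 by rewrite divr_gt0.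
have [C hC] := subpolynomial_LX m (x / 2) x2.
have c0 : 0 < c by exact: expR_gt0.
have cC : C * u `^ (x / 2) @[u --> 0^'+] --> 0.
  by rewrite -[X in _ --> X](mulr0 C); apply: cvgM; [exact: cvg_cst|exact: powR_cvg0].
apply/cvgr0Pnorm_le => e e0; near=> u.
have u0 : 0 < u by [].
have uc : u <= c by near: u; exact: nbhs_right_le.
have : `|C * u `^ (x / 2)| <= e by near: u; move/cvgr0Pnorm_le : cC; exact.
apply: le_trans; apply: le_trans (ler_norm _).
have -> : u `^ x = u `^ (x / 2) * u `^ (x / 2).
  by rewrite -powRD ?(gt_eqF u0) ?implybT//; congr (_ `^ _); field.
rewrite normrM ger0_norm; last by rewrite mulr_ge0 ?powR_ge0.
have := hC u; rewrite u0 uc => /(_ isT); rewrite powRN => h.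
have p0 : 0 < u `^ (x / 2) by exact: powR_gt0.
rewrite (mulrC C) -mulrA ler_pM2l// mulrC -ler_pdivlMr// mulrC.
Unshelve. all: by end_near. Qed.

(** Repeated integration by parts of x u^(x - 1) L^m, using L' = -1 / u. At c the boundary terms
    vanish with L, leaving c^x m! / x^m with c^x = e^(-g x); at 0 everything vanishes. *)
Fixpoint powR_log_primitive (x : R) (m : nat) (u : R) : R :=
  if m is m'.+1 then u `^ x * (- g - ln u) ^+ m + m%:R / x * powR_log_primitive x m' u
  else u `^ x.

Let F := powR_log_primitive.

Let is_derive_F (x : R) m (u : R) : 0 < x -> 0 < u ->
  is_derive u 1 (F x m) (x * u `^ (x - 1) * L u ^+ m).
Proof.
move=> x0 u0; elim: m => [|m ih]; first by rewrite expr0 mulr1; exact: is_derive1_powR.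
have dL := is_derive_L u u0.
have dX := is_derive1_powR x u0.
have dF := is_deriveD (is_deriveM dX (is_deriveX m.+1 dL)) (is_deriveZ (m.+1%:R / x) ih).
apply: is_derive_congr dF _ _ => [v|]; first by rewrite !fctE.
rewrite fctE /GRing.scale/= -(mulr_powRB1 (ltW u0) x0).
move: (F x m) (m.+1%:R) (u `^ _) (L u) {ih dL dX} => _ k p l; rewrite exprS; field.
by rewrite !gt_eqF.
Qed.

Let F_at_c (x : R) m : 0 < x -> F x m c = expR (- g * x) * m`!%:R / x ^+ m.
Proof.
move=> x0; elim: m => [|m ih].
  rewrite /= fact0 expr0 divr1 mulr1 /powR gt_eqF ?expR_gt0// expRK mulrC.
  by [].
rewrite /F/= -/(F x m c) ih expRK subrr expr0n/= mulr0 add0r factS natrM exprS.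
by field; rewrite !gt_eqF// exprn_gt0.
Qed.

Lemma integral_powR_log (x : R) m : 0 < x ->
  (\int[mu]_(u in `]0%R, c]) (x * u `^ (x - 1) * L u ^+ m)%:E =
   (expR (- g * x) * m`!%:R / x ^+ m)%:E)%E.
Proof.
move=> x0; rewrite -F_at_c//; apply: (@ge0_FTC2_at0 _ _ (F x m)).
- exact: expR_gt0.
- by move=> u uc; rewrite !mulr_ge0 ?powR_ge0 ?exprn_ge0 ?L_ge0// ltW.
- move=> u u0; apply: continuousM.
    apply: continuousM; first exact: cst_continuous.
    exact: is_derive_continuous (is_derive1_powR _ u0).
  apply: (@continuous_comp _ _ _ L (fun y => y ^+ m)); last exact: exprn_continuous.
  exact: is_derive_continuous (is_derive_L _ u0).
- by move=> u u0; exact: is_derive_F.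
elim: m => [|m ih]; first exact: powR_cvg0.
rewrite -[X in _ --> X](addr0 0) -[X in _ + X](mulr0 (m.+1%:R / x)).
apply: cvgD; first exact: cvg_powR_LX.
by apply: cvgM => //; exact: cvg_cst.
Qed.

Lemma integrable_powR_log (x : R) m : 0 < x ->
  mu.-integrable `]0, c] (EFin \o (fun u => x * u `^ (x - 1) * L u ^+ m)).
Proof.
move=> x0; apply/integrableP; split.
  apply/measurable_EFinP; apply: measurable_funM.
    by apply: measurable_funM => //; exact: measurable_funTS (measurable_powR _).
  apply: measurable_funX; apply: measurable_funB => //.
  apply: measurable_funTS; exact: measurable_ln.
rewrite (_ : integral _ _ _ = \int[mu]_(u in `]0%R, c]) (x * u `^ (x - 1) * L u ^+ m)%:E)%E.
  by rewrite integral_powR_log// ltry.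
apply: eq_integral => u; rewrite inE/= in_itv/= => uc.
by rewrite ger0_norm// !mulr_ge0 ?powR_ge0 ?exprn_ge0 ?L_ge0// ltW.
Qed.

End main_term.

(** Each factor is L u - ln omega_i, so expanding the product in powers of L u makes Lambda_k the
    coefficient of (-1)^k (L u)^(r - k). *)
Lemma integral_main_term {R : realType} r (omega : r.-tuple R) (x : R) :
  (forall i, 0 < tnth omega i) -> 0 < x ->
  let D := `]0, expR (- euler_gamma R)]%classic : set R in
  let f u := x * u `^ (x - 1) * \prod_(i < r) expint1_asym (tnth omega i) u in
  lebesgue_measure.-integrable D (EFin \o f) /\
  \int[lebesgue_measure]_(u in D) f u = expR (- euler_gamma R * x) *
     \sum_(0 <= k < r.+1) (-1) ^+ k * Lambda k omega * ((r - k)`!%:R / x ^+ (r - k)).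
Proof.
move=> w0 x0 D f.
have fE u : u \in D -> f u = \sum_(0 <= k < r.+1) ((-1) ^+ k * Lambda k omega) *
    (x * u `^ (x - 1) * (- euler_gamma R - ln u) ^+ (r - k)).
  rewrite inE /D/= in_itv/= => /andP[u0 _]; rewrite /f.
  rewrite (eq_bigr (fun i => (- euler_gamma R - ln u) - ln (tnth omega i))).
    rewrite prod_subr_subsets mulr_sumr; apply: eq_bigr => k _.
    by rewrite /Lambda; ring.
  by move=> i _; rewrite /expint1_asym lnM ?posrE//; ring.
have [i1 i2] := @Rintegral_lincomb R D r.+1 (fun k => (-1) ^+ k * Lambda k omega)
  (fun k u => x * u `^ (x - 1) * (- euler_gamma R - ln u) ^+ (r - k))
  (measurable_itv _) (fun k => integrable_powR_log _ x (r - k) x0).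
split.
  apply: eq_integrable i1; first exact: measurable_itv.
  by move=> u uD; rewrite /= fE.
rewrite mulr_sumr; apply: etrans (etrans i2 _).
  by apply: eq_Rintegral => u; exact: fE.
apply: eq_bigr => k _.
rewrite /Rintegral integral_powR_log//=; ring.
Qed.

(** * Bounds linear in x for the replacement error and for the tail *)

Section remainder_bounds.
Context {R : realType}.
Notation mu := (@lebesgue_measure R).
Context {r : nat} (omega : r.-tuple R) (a c : R).
Hypothesis omega_gt0 : forall i, 0 < tnth omega i.
Hypotheses (a_ge0 : 0 <= a) (c_gt0 : 0 < c).

Let main_integrand (x u : R) :=
  x * u `^ (x - 1) * \prod_(i < r) expint1_asym (tnth omega i) u.

Let measurable_main_integrand (x : R) (D : set R) : measurable_fun D (main_integrand x).
Proof.
apply: measurable_funTS; apply: measurable_funM.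
  by apply: measurable_funM => //; exact: measurable_powR.
apply: (measurable_prod (s := index_enum 'I_r)
  (h := fun i => expint1_asym (tnth omega i))) => i _.
apply: measurable_funB => //.
apply: (measurableT_comp (f := @ln R)); first exact: measurable_ln.
exact: mulrl_measurable.
Qed.

(** Writing x u^(x - 1) as x u^x / u hands the factor 1 / u to the difference of products, which
    vanishes fast enough at 0 to absorb it. *)
Lemma mellin_integrandB_main_bound : exists K, forall x : R, 0 < x <= 1 ->
  let g u := mellin_integrand omega x a u - main_integrand x u in
  mu.-integrable `]0, c] (EFin \o g) /\ `|\int[mu]_(u in `]0, c]) g u| <= x * K.
Proof.
have h2 : 0 < 2^-1 :> R by rewrite invr_gt0.
have [C hC] := subpolynomial_mellinB r omega a c omega_gt0 a_ge0 2^-1 h2.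
(* [M] bounds u^x for all u in ]0, c] and all x in ]0, 1], which keeps the final constant
   independent of x. *)
pose M := Num.max 1 c; have M1 : 1 <= M by rewrite le_max lexx.
exists (M * C * 2 * c `^ 2^-1) => x x01 g; have /andP[x0 x1] := x01.
(* This is x M C u^(-1/2), written as a multiple of the integrand of [integral_powR_itv0c] at
   exponent 1/2. *)
pose b (u : R) := x * M * C * 2 * (2^-1 * u `^ (2^-1 - 1)).
have gb u : 0 < u <= c -> `|g u| <= b u.
  move=> uc; have /andP[u0 uc'] := uc.
  have -> : g u = x * u `^ x * ((expR (- (a * u)) *
      \prod_(i < r) expint1 (tnth omega i * u) -
      \prod_(i < r) expint1_asym (tnth omega i) u) / u).
    rewrite /g /mellin_integrand /main_integrand -(mulr_powRB1 (ltW u0) x0).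
    by field; rewrite gt_eqF.
  rewrite normrM ger0_norm ?mulr_ge0 ?powR_ge0 ?(ltW x0)//.
  have uM : u `^ x <= M.
    apply: (@le_trans _ _ (M `^ x)); last exact: ler1_powR.
    apply: ge0_ler_powR; rewrite ?nnegrE ?(ltW x0) ?(ltW u0)//.
      exact: le_trans ler01 M1.
    by rewrite (le_trans uc')// le_max lexx orbT.
  have -> : b u = x * M * (C * u `^ (- 2^-1)).
    rewrite /b (_ : 2^-1 - 1 = - 2^-1 :> R); last by field.
    by field.
  apply: ler_pM; rewrite ?mulr_ge0 ?powR_ge0 ?(ltW x0)//.
    by rewrite ler_wpM2l// ltW.
  exact: hC.
have ib0 : mu.-integrable `]0, c] (EFin \o (fun u : R => 2^-1 * u `^ (2^-1 - 1))).
  apply/integrableP; split.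
    apply/measurable_EFinP; apply: measurable_funM => //.
    by apply: measurable_funTS; exact: measurable_powR.
  under eq_integral do rewrite /= ger0_norm ?mulr_ge0 ?powR_ge0 ?(ltW h2)//.
  by rewrite integral_powR_itv0c// ltry.
have ib : mu.-integrable `]0, c] (EFin \o b).
  by apply: (integrableZl _ _ ib0).
have ig : mu.-integrable `]0, c] (EFin \o g).
  apply: le_integrable ib => //.
    apply/measurable_EFinP; apply: measurable_funB => //.
    apply: (@measurable_funS _ _ _ _ (`]0, +oo[ : set R)) => //; last first.
      exact: measurable_mellin_integrand.
    by apply: subset_itvl.
    exact: measurable_main_integrand.
  move=> u; rewrite /= in_itv/= => uc; rewrite lee_fin (le_trans (gb u uc))//.
  exact: ler_norm.
split => //.
apply: le_trans (le_normr_Rintegral _ ig) _ => //.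
have -> : x * (M * C * 2 * c `^ 2^-1) = \int[mu]_(u in `]0, c]) b u.
  rewrite /b RintegralZl// /Rintegral integral_powR_itv0c//=; ring.
by apply: le_Rintegral => //; exact: integrable_norm.
Qed.

(** As a may be 0, decay is taken from one factor, E1 (w u) <= e^(-w u) / (w u), which exists
    because r > 0. The other factors are at most their values at c, and u^(x - 1) <= (1 / c)^(1 - x)
    <= max(1, 1 / c). *)
Lemma mellin_tail_bound : (0 < r)%N -> exists K, forall x : R, 0 < x <= 1 ->
  (\int[mu]_(u in `]c, +oo[) (mellin_integrand omega x a u)%:E <= (x * K)%:E)%E.
Proof.
move=> r0; pose i0 := Ordinal r0; pose w := tnth omega i0.
have w0 : 0 < w by exact: omega_gt0.
pose M := Num.max 1 c^-1; have M1 : 1 <= M by rewrite le_max lexx.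
have M0 : 0 <= M by rewrite (le_trans ler01).
pose P := \prod_(i < r | i != i0) expint1 (tnth omega i * c).
have P0 : 0 <= P by apply: prodr_ge0 => i _; exact: expint1_ge0.
exists (M * (w * c)^-1 * P * (expR (- (w * c)) / w)) => x /andP[x0 x1].
have wc0 : 0 < w * c by rewrite mulr_gt0.
have k0 : 0 <= x * M * (w * c)^-1 * P.
  by rewrite !mulr_ge0 ?invr_ge0// ltW.
apply: (@le_trans _ _ (\int[mu]_(u in `]c, +oo[)
    ((x * M * (w * c)^-1 * P)%:E * (expR (- (w * u)))%:E))%E); last first.
  rewrite ge0_integralZl_EFin//.
  - rewrite integral_itv_obnd_cbnd; last first.
      by apply/measurable_EFinP; exact: measurable_expR_mul.
    by rewrite integral_expR_itvy// -EFinM lee_fin le_eqVlt; apply/orP; left; apply/eqP; ring.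
  - by apply/measurable_EFinP; exact: measurable_expR_mul.
apply: ge0_le_integral => //.
- by move=> u _; rewrite lee_fin mellin_integrand_ge0// ltW.
- apply/measurable_EFinP.
  apply: (@measurable_funS _ _ _ _ (`]0, +oo[ : set R)) => //; last first.
    exact: measurable_mellin_integrand.
  by apply: subset_itvr; rewrite bnd_simp ltW.
- apply/measurable_EFinP; apply: measurable_funM => //; exact: measurable_expR_mul.
move=> u; rewrite /= in_itv/= andbT => cu; rewrite -EFinM lee_fin.
have u0 : 0 < u by exact: lt_trans cu.
have cuW := ltW cu.
have hx : u `^ (x - 1) <= M.
  rewrite -opprB powRN.
  have x1' : 0 <= 1 - x by rewrite subr_ge0.
  apply: (@le_trans _ _ (c `^ (1 - x))^-1).
    rewrite lef_pV2 ?posrE ?powR_gt0//.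
    by apply: ge0_ler_powR; rewrite ?nnegrE// ltW.
  rewrite -powRN -mulN1r powRrM powR_inv1 ?(ltW c_gt0)//.
  apply: (@le_trans _ _ (M `^ (1 - x))); last by apply: ler1_powR => //; lra.
  apply: ge0_ler_powR; rewrite ?nnegrE// ?invr_ge0 ?(ltW c_gt0)//.
  by rewrite le_max lexx orbT.
have he : expR (- (a * u)) <= 1.
  by rewrite -expR0 ler_expR oppr_le0 mulr_ge0// ltW.
rewrite /mellin_integrand (bigD1 i0)//= -/w.
have hP : \prod_(i < r | i != i0) expint1 (tnth omega i * u) <= P.
  apply: ler_prod => i _; rewrite expint1_ge0/=.
  by apply: expint1_nincr; rewrite ?mulr_gt0// ler_pM2l.
have hw : expint1 (w * u) <= (w * c)^-1 * expR (- (w * u)).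
  have wu0 : 0 < w * u by rewrite mulr_gt0.
  apply: le_trans (expint1_le _ wu0) _; rewrite mulrC ler_wpM2r ?expR_ge0//.
  by rewrite lef_pV2 ?posrE// ler_pM2l.
have P'0 : 0 <= \prod_(i < r | i != i0) expint1 (tnth omega i * u).
  by apply: prodr_ge0 => i _; exact: expint1_ge0.
rewrite -[leRHS]mulr1 (_ : x * M * (w * c)^-1 * P * expR (- (w * u)) * 1 =
  x * M * 1 * ((w * c)^-1 * expR (- (w * u)) * P)); last by ring.
have xh : x * u `^ (x - 1) <= x * M by rewrite ler_wpM2l// ltW.
by rewrite !ler_pM ?mulr_ge0 ?powR_ge0 ?expR_ge0 ?expint1_ge0// ltW.
Qed.

End remainder_bounds.

(** * Splitting the single integral at c and collecting the error *)

Theorem theorem1p1 (R : realType) (r : nat) (omega : r.-tuple R) (a : R)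
    (r_gt0 : (0 < r)%N) (omega_gt0 : forall i : 'I_r, 0 < tnth omega i)
    (a_ge0 : 0 <= a) :
  (fun x : R => Ir x omega a) =
  (fun x : R => expR (- euler_gamma R * x) / Gamma (x + 1) *
     \sum_(0 <= k < r.+1)
        (-1) ^+ k * Lambda k omega * ((r - k)`!%:R / x ^+ (r - k)))
  +O_ (0^'+) (fun x : R => x).
Proof.
pose c := expR (- euler_gamma R); have c0 : 0 < c by exact: expR_gt0.
have [K1 hK1] := mellin_integrandB_main_bound omega a c omega_gt0 a_ge0 c0.
have [K2 hK2] := mellin_tail_bound omega a c omega_gt0 a_ge0 c0 r_gt0.
apply/eqaddOP; near=> k; near=> x.
have x0 : 0 < x by [].
have x1 : x <= 1 by near: x; exact: nbhs_right_le.
have x01 : 0 < x <= 1 by rewrite x0.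
have [ig gK] := hK1 x x01.
have [im Em] := integral_main_term _ omega x omega_gt0 x0.
have G0 : 0 < Gamma (x + 1) by apply: lt_le_trans (Gamma_ge _ x01); exact: expR_gt0.
have tK := hK2 x x01.
pose mi := mellin_integrand omega x a.
pose T := (\int[lebesgue_measure]_(u in `]c, +oo[) (mi u)%:E)%E.
have T0 : (0 <= T)%E.
  by apply: integral_ge0 => u _; rewrite lee_fin mellin_integrand_ge0// ltW.
(* The linear bound also makes the tail finite, which is needed to split [fine] over the two
   intervals. *)
have Tfin : T \is a fin_num by rewrite ge0_fin_numE// (le_lt_trans tK)// ltry.
have miE : mi = fun u => (mi u - x * u `^ (x - 1) *
    \prod_(i < r) expint1_asym (tnth omega i) u) +
    x * u `^ (x - 1) * \prod_(i < r) expint1_asym (tnth omega i) u.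
  by apply/funext => u; rewrite subrK.
have imi : lebesgue_measure.-integrable `]0, c] (EFin \o mi).
  rewrite miE; by apply: (integrableD _ ig im).
have split_int : \int[lebesgue_measure]_(u in `]0, +oo[) mi u =
    \int[lebesgue_measure]_(u in `]0, c]) mi u + fine T.
  rewrite /Rintegral -fineD//; last exact: integrable_fin_num imi.
  have U : `]0, +oo[%classic = `]0, c] `|` `]c, +oo[ :> set R.
    by rewrite -itv_bndbnd_setU// bnd_simp// ltW.
  congr fine; rewrite U ge0_integral_setU//.
  - by rewrite -U; apply/measurable_EFinP; exact: measurable_mellin_integrand.
  - by move=> u _; rewrite lee_fin mellin_integrand_ge0// ltW.
  - apply/disj_setPS => u [] /=; rewrite !in_itv/= andbT => /andP[_ uc] cu.
    by have := le_lt_trans uc cu; rewrite ltxx.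
rewrite !fctE /= (Ir_mellin _ omega x a r_gt0 omega_gt0 x01 a_ge0) split_int.
rewrite (_ : \int[lebesgue_measure]_(u in `]0, c]) mi u =
    \int[lebesgue_measure]_(u in `]0, c]) (mi u - x * u `^ (x - 1) *
      \prod_(i < r) expint1_asym (tnth omega i) u) +
    \int[lebesgue_measure]_(u in `]0, c]) (x * u `^ (x - 1) *
      \prod_(i < r) expint1_asym (tnth omega i) u)); last first.
  by rewrite {1}miE RintegralD.
rewrite Em; set J := Rintegral _ _ _; set S := \sum_(0 <= _ < _) _.
rewrite (_ : _ - _ = (Gamma (x + 1))^-1 * (J + fine T)); last by ring.
have tK' : `|fine T| <= x * K2.
  by rewrite ger0_norm ?fine_ge0// -lee_fin fineK.
rewrite normrM ger0_norm ?invr_ge0 ?(ltW G0)// (gtr0_norm x0).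
have Gi : (Gamma (x + 1))^-1 <= expR 1.
  rewrite -[expR 1]invrK -expRN lef_pV2 ?posrE ?expR_gt0//; exact: Gamma_ge.
(* The implied constant is e (K1 + K2), below any [k] close enough to +oo. *)
apply: (@le_trans _ _ (expR 1 * (x * K1 + x * K2))).
  apply: ler_pM => //; first by rewrite invr_ge0 ltW.
  by apply: le_trans (ler_normD _ _) _; exact: lerD.
by rewrite -mulrDr mulrCA mulrC ler_pM2r.
Unshelve. all: by end_near. Qed.
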